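(* For every $\delta>0$, every positive integer $r$ and every finite subset $X\subset\mathbb{Z}^r$ there is a positive integer $N$ such that every subset $A$ of the grid $\{1,2,\dots,N\}^r$ of size at least $\delta N^r$ has a subset of the form $a+dX=\{a+dx:x\in X\}$ for some $a\in\mathbb{Z}^r$ and some positive integer $d$. *)

(* Defs.v *)
From mathcomp Require Import all_boot all_order all_algebra.
From mathcomp Require Import finmap.
From mathcomp Require Import reals.

Set Implicit Arguments.
Unset Strict Implicit.
Unset Printing Implicit Defensive.

Import Order.TTheory GRing.Theory Num.Theory.
Local Open Scope fset_scope.
Local Open Scope ring_scope.

Definition grid (r N : nat) : pred 'rV[int]_r :=
  [pred x : 'rV[int]_r | [forall i, 1 <= x ord0 i <= N%:Z]].

Arguments grid : clear implicits.

Definition homothet (r : nat) (a : 'rV[int]_r) (d : int)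
    (X : {fset 'rV[int]_r}) : {fset 'rV[int]_r} :=
  [fset a + d *: x | x : 'rV[int]_r in X].

(* Main.v *)
Require Import Defs.
From mathcomp Require Import all_boot all_order all_algebra.
From mathcomp Require Import finmap.
From mathcomp Require Import boolp reals.
From mathcomp Require Import ring lra zify.

Set Implicit Arguments.
Unset Strict Implicit.
Unset Printing Implicit Defensive.

Import Order.TTheory GRing.Theory Num.Theory.
Local Open Scope fset_scope.
Local Open Scope ring_scope.

(** The theorem follows from the density Hales-Jewett theorem: for a finite alphabet
    and a positive density, every set of long words of at least that density contains
    a combinatorial line, that is, all the words obtained from one word with wildcards
    by substituting the same letter for every wildcard. Take the points of [X] as
    letters and send a word to the sum of its letters, translated by a random vector
    of a slightly larger grid. On average over the translations, the words sent into
    [A] are dense, so for one translation they contain a line; its image is a homothetic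
    copy of [X], with ratio the number of wildcards.

    The density Hales-Jewett theorem is proved by induction on the alphabet, passing
    from [T] to [option T], along the lines of the arguments of Polymath and of Dodos,
    Kanellopoulos and Tyros. Let [d] be the infimum of the densities that force a line
    over [option T], and suppose that [d] is positive. A line-free set [B] of density
    nearly [d] has density nearly [d] on all subspaces of a suitable kind. Whenever the
    words obtained from [x] by substituting a letter [t] of [T] for all [None] belong to
    [B] for every [t], the word [x] itself does not, or there would be a line. So [B] is
    almost disjoint from an intersection of sets, one for each [t], that do not
    distinguish [None] from [Some t]; and the theorem for [T], with the Graham-Rothschild
    theorem for lines, shows that this intersection is not negligible
    ([popular_line], [graham_rothschild]). Hence [B] has density greater than [d] by a
    definite amount on the complement. On the other hand, insensitive sets and their
    intersections are nearly disjoint unions of large subspaces, on which the density of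
    [B] is at most about [d] ([avg_compl_insens_le]): a contradiction.

    Words are functions from an arbitrary finite type of coordinates, and subspaces are
    templates, so that subspaces of subspaces and products of subspaces need no
    reindexing. The decomposition into subspaces is never constructed; only its
    consequence for averages is stated. *)

(** * Averages over finite types *)

Section Averages.
Variable R : realType.

(** The average is $0$ on an empty type, whence the inhabitants [x0] or [t0] that
    some lemmas require. *)
Definition avg (X : finType) (f : X -> R) : R := (\sum_x f x) / #|X|%:R.

Definition mu (X : finType) (P : pred X) : R := avg (fun x => (P x)%:R).

Lemma eq_avg (X : finType) (f g : X -> R) : f =1 g -> avg f = avg g.
Proof. by move=> fg; rewrite /avg (eq_bigr _ (fun x _ => fg x)). Qed.

Lemma eq_mu (X : finType) (P Q : pred X) : P =1 Q -> mu P = mu Q.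
Proof. by move=> PQ; apply: eq_avg => x; rewrite PQ. Qed.

Lemma avgD (X : finType) (f g : X -> R) :
  avg (fun x => f x + g x) = avg f + avg g.
Proof. by rewrite /avg big_split mulrDl. Qed.

Lemma avgZ (X : finType) (c : R) (f : X -> R) :
  avg (fun x => c * f x) = c * avg f.
Proof. by rewrite /avg -mulr_sumr mulrA. Qed.

Lemma avgB (X : finType) (f g : X -> R) :
  avg (fun x => f x - g x) = avg f - avg g.
Proof.
rewrite /avg -mulrBl; congr (_ / _).
by rewrite -(sumrN (index_enum X)) -big_split.
Qed.

Lemma avg_cst (X : finType) (x0 : X) (c : R) : avg (fun _ : X => c) = c.
Proof.
rewrite /avg sumr_const -[c *+ _]mulr_natr mulfK // pnatr_eq0 -lt0n.
by apply/card_gt0P; exists x0.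
Qed.

Lemma le_avg (X : finType) (f g : X -> R) :
  (forall x, f x <= g x) -> avg f <= avg g.
Proof.
by move=> fg; rewrite ler_wpM2r ?invr_ge0 ?ler0n //; apply: ler_sum => x _.
Qed.

Lemma avg_ge0 (X : finType) (f : X -> R) : (forall x, 0 <= f x) -> 0 <= avg f.
Proof. by move=> f0; rewrite divr_ge0 ?ler0n ?sumr_ge0. Qed.

Lemma mu_card (X : finType) (P : pred X) : mu P = #|P|%:R / #|X|%:R.
Proof. by rewrite /mu /avg -natr_sum -sum1_card [in RHS]big_mkcond. Qed.

Lemma mu_ge0 (X : finType) (P : pred X) : 0 <= mu P.
Proof. by apply: avg_ge0 => x; rewrite ler0n. Qed.

Lemma mu_le (X : finType) (P Q : pred X) :
  (forall x, P x -> Q x) -> mu P <= mu Q.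
Proof.
move=> PQ; apply: le_avg => x.
by case: (boolP (P x)) => [/PQ -> //|_]; rewrite ler0n.
Qed.

Lemma mu_le1 (X : finType) (P : pred X) : mu P <= 1.
Proof.
case: (posnP #|X|) => [X0|].
  by rewrite /mu /avg X0 invr0 mulr0 ler01.
case/card_gt0P=> x0 _; rewrite -[leRHS](avg_cst x0).
by apply: le_avg => x; case: (P x); rewrite ?ler01.
Qed.

Lemma avg_exchange (X Y : finType) (f : X -> Y -> R) :
  avg (fun x => avg (f x)) = avg (fun y => avg (f^~ y)).
Proof.
rewrite /avg -!mulr_suml exchange_big /= -!mulrA.
by rewrite [_^-1 * _]mulrC.
Qed.

Lemma avg_pair (X Y : finType) (f : X -> Y -> R) :
  avg (fun x => avg (f x)) = avg (fun p : X * Y => f p.1 p.2).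
Proof.
rewrite /avg -mulr_suml pair_big /= card_prod natrM invfM mulrA.
by rewrite mulrAC.
Qed.

Lemma avg_bij (X Y : finType) (h : X -> Y) (f : Y -> R) :
  bijective h -> avg (f \o h) = avg f.
Proof.
move=> bh; rewrite /avg (bij_eq_card bh); congr (_ / _).
have [g hg gh] := bh.
rewrite [RHS](reindex h) //; exists g => x _; [exact: hg | exact: gh].
Qed.

Lemma avg_fst (X Y : finType) (y0 : Y) (f : X -> R) :
  avg (fun p : X * Y => f p.1) = avg f.
Proof.
rewrite -(avg_pair (fun x _ => f x)).
by apply: eq_avg => x; rewrite (avg_cst y0).
Qed.

Lemma le_avg_ex (X : finType) (x0 : X) (f : X -> R) (c : R) :
  c <= avg f -> exists x, c <= f x.
Proof.
move=> cf; apply: contrapT => /forallNP h.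
have fc x : f x < c by rewrite ltNge; apply/negP/h.
suff : avg f < c by rewrite ltNge cf.
have Xp : 0 < #|X|%:R :> R by rewrite ltr0n; apply/card_gt0P; exists x0.
rewrite ltr_pdivrMr // mulr_natr -sumr_const.
by apply: ltr_sum => //; apply/hasP; exists x0; rewrite ?mem_index_enum.
Qed.

(** A reverse Markov inequality, from the pointwise bound [g <= [c <= g] + c]:
    when the sections of a set have large average density, many of them are
    dense. *)
Lemma avg_le_mu (X : finType) (x0 : X) (g : X -> R) (c : R) :
  0 <= c -> (forall x, g x <= 1) -> avg g <= mu (fun x => c <= g x) + c.
Proof.
move=> c0 g1; rewrite -{2}(avg_cst x0 c) -avgD; apply: le_avg => x.
by case: (leP c (g x)) => [_|/ltW]; [rewrite ler_wpDr | rewrite add0r].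
Qed.

(** The sets [Q^~ y] cover [P], so one of them carries its share of the mass.
    Applied to lines, it makes the line independent of the section in which it was
    found, at the cost of dividing the density by the number of candidates. *)
Lemma mu_pigeonhole (X Y : finType) (P : pred X) (Q : X -> pred Y) :
  0 < mu P -> (forall x, P x -> exists y, Q x y) ->
  exists y, mu P / #|Y|%:R <= mu (Q^~ y).
Proof.
move=> P0 PQ.
have [y0 _] : exists y0 : Y, true.
  apply: contrapT => nY; move: P0; rewrite ltNge => /negP; apply.
  rewrite [leRHS](_ : 0 = mu (fun _ : X => false)); last first.
    by rewrite /mu /avg big1 ?mul0r.
  by apply: mu_le => x /PQ [y _]; case: nY; exists y.
apply: (le_avg_ex y0); rewrite -avg_exchange /mu -[avg _ / _]mulrC -avgZ.
apply: le_avg => x; rewrite /avg mulrC ler_wpM2r ?invr_ge0 ?ler0n //.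
case: (boolP (P x)) => [/PQ[y Qxy]|_]; last first.
  by apply: sumr_ge0 => y _; rewrite ler0n.
by rewrite (bigD1 y) //= Qxy ler_wpDr // sumr_ge0 // => z _; rewrite ler0n.
Qed.

Lemma avg_lt1 (X : finType) (f : X -> R) x0 :
  (forall x, f x <= 1) -> f x0 < 1 -> avg f < 1.
Proof.
move=> f1 fx0; rewrite /avg ltr_pdivrMr; last first.
  by rewrite ltr0n; apply/card_gt0P; exists x0.
rewrite mul1r -sum1_card natr_sum (bigD1 x0) //= [ltRHS](bigD1 x0) //=.
by apply: ltr_leD => //; apply: ler_sum.
Qed.

Lemma mu_predT (X : finType) (x0 : X) : mu (fun _ : X => true) = 1.
Proof. exact: avg_cst. Qed.

Lemma avg_affine (X : finType) (x0 : X) (a b : R) (g : X -> R) :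
  avg (fun x => a + b * (g x - a)) = a + b * (avg g - a).
Proof. by rewrite avgD avgZ avgB !(avg_cst x0). Qed.

Lemma le_card_avg (X : finType) (f : X -> R) x :
  (forall x, 0 <= f x) -> f x <= #|X|%:R * avg f.
Proof.
move=> f0; have X0 : #|X|%:R != 0 :> R.
  by rewrite pnatr_eq0 -lt0n; apply/card_gt0P; exists x.
rewrite /avg mulrC mulfVK // (bigD1 x) //= ler_wpDr //.
by apply: sumr_ge0.
Qed.

Lemma avg_prod (I A : finType) (g : A -> R) :
  avg (fun x : {ffun I -> A} => \prod_i g (x i)) = avg g ^+ #|I|.
Proof.
rewrite /avg -(bigA_distr_bigA (fun _ => g)) /= prodr_const card_ffun.
by rewrite natrX exprMn exprVn.
Qed.

(** Bernoulli's inequality in the form [q ^+ n * (1 + n * (1 - q)) <= 1]. *)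
Lemma expr_small (q eps : R) : 0 <= q < 1 -> 0 < eps ->
  exists n0, forall n, (n0 <= n)%N -> q ^+ n <= eps.
Proof.
case/andP=> q0 q1 e0.
pose n0 := Num.bound ((eps * (1 - q))^-1).
have p0 : 0 < eps * (1 - q) by rewrite mulr_gt0 // subr_gt0.
have bern n : q ^+ n * (1 + n%:R * (1 - q)) <= 1.
  elim: n => [|n IH]; first by rewrite expr0 mul0r addr0 mulr1.
  have qn : 0 <= q ^+ n by rewrite exprn_ge0.
  have n0' : 0 <= n%:R :> R by rewrite ler0n.
  apply: le_trans IH; rewrite exprS -natr1 mulrAC mulrC.
  rewrite ler_wpM2l //.
  have : 0 <= n%:R * (1 - q) ^+ 2 by rewrite mulr_ge0 ?sqr_ge0.
  have : 0 <= (1 - q) ^+ 2 by rewrite sqr_ge0.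
  nra.
exists n0 => n n0n.
have nb : (eps * (1 - q))^-1 < n%:R.
  apply: lt_le_trans (_ : n0%:R <= _); last by rewrite ler_nat.
  by apply: archi_boundP; rewrite invr_ge0 ltW.
have {}nb : eps^-1 < n%:R * (1 - q).
  by rewrite invfM ltr_pdivrMr ?subr_gt0 in nb.
have := bern n; have := exprn_ge0 n q0; set Q := q ^+ n => Q0 hb.
have e1 : 1 = eps * eps^-1 by rewrite mulfV // gt_eqF.
rewrite leNgt; apply/negP => eQ.
have i0 : 0 < eps^-1 by rewrite invr_gt0.
have : eps * eps^-1 < Q * (n%:R * (1 - q)).
  by apply: ltr_pM => //; apply: ltW.
nra.
Qed.

End Averages.
Arguments mu : clear implicits.
Arguments mu R {X} P.

(** * Words, lines and subspaces *)

Section Templates.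

(** A combinatorial subspace of the words of shape [I] is a template [s]: every
    coordinate carries either a fixed letter or one of the variables [j : J], and
    [app s w] replaces the variables by the letters of [w]. *)
Definition app (I J T : finType) (s : {ffun I -> T + J}) (w : {ffun J -> T}) :
  {ffun I -> T} := [ffun i => match s i with inl a => a | inr j => w j end].

(** The dimension of a template is genuinely [#|J|] only if each variable
    occurs. *)
Definition full (I J T : finType) (s : {ffun I -> T + J}) : bool :=
  [forall j, exists i, s i == inr j].

Lemma fullP (I J T : finType) (s : {ffun I -> T + J}) :
  reflect (forall j, exists i, s i = inr j) (full s).
Proof.
apply: (iffP forallP) => h j; first by case/existsP: (h j) => i /eqP; exists i.
by apply/existsP; have [i /eqP] := h j; exists i.
Qed.

Lemma app_inj (I J T : finType) (s : {ffun I -> T + J}) :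
  full s -> injective (app s).
Proof.
move/fullP=> fs w w' ww; apply/ffunP => j; have [i si] := fs j.
by have /ffunP/(_ i) := ww; rewrite !ffunE si.
Qed.

Definition tcomp (I J K T : finType) (s : {ffun I -> T + J})
    (u : {ffun J -> T + K}) : {ffun I -> T + K} :=
  [ffun i => match s i with inl a => inl a | inr j => u j end].

Lemma full_comp (I J K T : finType) (s : {ffun I -> T + J})
    (u : {ffun J -> T + K}) : full s -> full u -> full (tcomp s u).
Proof.
move=> /fullP fs /fullP fu; apply/fullP => k.
have [j uj] := fu k; have [i si] := fs j.
by exists i; rewrite ffunE si.
Qed.

Lemma app_comp (I J K T : finType) (s : {ffun I -> T + J})
    (u : {ffun J -> T + K}) w : app (tcomp s u) w = app s (app u w).
Proof. by apply/ffunP => i; rewrite !ffunE; case: (s i) => // j; rewrite ffunE. Qed.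

(** A word over [option T] plays two roles. It is a word over the alphabet [T]
    with one more letter [None], and it is a word over [T] in which [None] marks the
    wildcard of a line, whose points are the [subst x t]. That both are the same
    object is what links lines over [T] with sets over [option T]. *)
Definition subst (I T : finType) (x : {ffun I -> option T}) (t : T) :
  {ffun I -> T} := [ffun i => odflt t (x i)].

Definition wsome (I T : finType) (w : {ffun I -> T}) : {ffun I -> option T} :=
  [ffun i => Some (w i)].

(** The same subspace over the larger alphabet, where the variables may take the
    value [None]; on words with a wildcard it maps lines to lines. *)
Definition wlift (I J T : finType) (s : {ffun I -> T + J}) :
  {ffun I -> option T + J} :=
  [ffun i => match s i with inl a => inl (Some a) | inr j => inr j end].

Lemma full_wlift (I J T : finType) (s : {ffun I -> T + J}) :
  full s -> full (wlift s).
Proof.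
by move=> /fullP fs; apply/fullP => j; have [i si] := fs j; exists i; rewrite ffunE si.
Qed.

Lemma wlift_comp (I J K T : finType) (s : {ffun I -> T + J})
    (u : {ffun J -> T + K}) : wlift (tcomp s u) = tcomp (wlift s) (wlift u).
Proof. by apply/ffunP => i; rewrite !ffunE; case: (s i) => // j; rewrite ffunE. Qed.

Lemma subst_app (I J T : finType) (s : {ffun I -> T + J}) x t :
  subst (app (wlift s) x) t = app s (subst x t).
Proof. by apply/ffunP => i; rewrite !ffunE; case: (s i) => // j; rewrite ffunE. Qed.

Lemma app_wsome (I J T : finType) (s : {ffun I -> T + J}) w :
  app (wlift s) (wsome w) = wsome (app s w).
Proof. by apply/ffunP => i; rewrite !ffunE; case: (s i) => // j; rewrite ffunE. Qed.

Definition has_None (I T : finType) (x : {ffun I -> option T}) : bool :=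
  [exists i, x i == None].

Lemma has_None_app (I J T : finType) (s : {ffun I -> option T + J})
    (x : {ffun J -> option T}) : full s -> has_None x -> has_None (app s x).
Proof.
move=> /fullP fs /existsP[j /eqP xj]; have [i si] := fs j.
by apply/existsP; exists i; rewrite ffunE si xj.
Qed.

Definition has_line (I T : finType) (A : pred {ffun I -> T}) : Prop :=
  exists2 L : {ffun I -> option T}, has_None L & forall t, A (subst L t).

Lemma has_line_app (I J T : finType) (s : {ffun I -> T + J})
    (A : pred {ffun I -> T}) :
  full s -> has_line (fun w => A (app s w)) -> has_line A.
Proof.
move=> fs [L NL AL]; exists (app (wlift s) L) => [|t].
  exact/has_None_app/NL/full_wlift.
by rewrite subst_app.
Qed.

(** The subspace whose variables sit at the distinct coordinates [e j], the other
    coordinates being those of [y]. *)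
Definition extend (I J T : finType) (e : J -> I) (y : {ffun I -> T}) :
  {ffun I -> T + J} :=
  [ffun i => if [pick j | e j == i] is Some j then inr j else inl (y i)].

Lemma extend_in (I J T : finType) (e : J -> I) (y : {ffun I -> T}) j :
  injective e -> extend e y (e j) = inr j.
Proof.
move=> ie; rewrite ffunE; case: pickP => [j' /eqP/ie -> //|/(_ j)].
by rewrite eqxx.
Qed.

Lemma full_extend (I J T : finType) (e : J -> I) (y : {ffun I -> T}) :
  injective e -> full (extend e y).
Proof. by move=> ie; apply/fullP => j; exists (e j); rewrite extend_in. Qed.

Lemma card_inj (I J : finType) : (#|J| <= #|I|)%N ->
  exists e : J -> I, injective e.
Proof.
move=> le; exists (fun j => enum_val (widen_ord le (enum_rank j))).
by move=> j j' /enum_val_inj /(congr1 val) /= /val_inj/enum_rank_inj.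
Qed.

Lemma full_exists (I J T : finType) (t0 : T) : (#|J| <= #|I|)%N ->
  exists s : {ffun I -> T + J}, full s.
Proof.
move=> /card_inj[e ie]; exists (extend e [ffun=> t0]); exact: full_extend.
Qed.

(** A random word is obtained from a random subspace parallel to the coordinates
    [e] and a random point in it. The map exchanging [w] with the part of [y] that
    it overwrites is an involution, hence preserves averages. *)
Lemma avg_extend (R : realType) (I J T : finType) (t0 : T) (e : J -> I)
    (f : {ffun I -> T} -> R) : injective e ->
  avg f = avg (fun y => avg (fun w => f (app (extend e y) w))).
Proof.
move=> ie.
pose h (p : {ffun I -> T} * {ffun J -> T}) :=
  (app (extend e p.1) p.2, [ffun j => p.1 (e j)] : {ffun J -> T}).
have hK : involutive h.
  move=> [y w]; congr (_, _); apply/ffunP => i; last first.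
    by rewrite ffunE /= ffunE extend_in.
  rewrite ffunE /= [extend e _ i]ffunE.
  case: pickP => [j /eqP <-|]; first by rewrite ffunE.
  by move=> /= ne; rewrite !ffunE; case: pickP => // j; rewrite ne.
rewrite (avg_pair (fun y w => f (app (extend e y) w))).
rewrite -(avg_fst ([ffun=> t0] : {ffun J -> T}) f).
rewrite -(avg_bij _ (inv_bij hK)).
by apply: eq_avg => -[y w].
Qed.

Definition wcat (J K T : finType) (x : {ffun J -> T}) (y : {ffun K -> T}) :
  {ffun J + K -> T} :=
  [ffun i => match i with inl j => x j | inr k => y k end].

Lemma avg_cat (R : realType) (J K T : finType) (f : {ffun J + K -> T} -> R) :
  avg f = avg (fun x => avg (fun y => f (wcat x y))).
Proof.
rewrite (avg_pair (fun x y => f (wcat x y))).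
pose h (p : {ffun J -> T} * {ffun K -> T}) := wcat p.1 p.2.
rewrite -(@avg_bij _ _ _ h) //.
pose g (w : {ffun J + K -> T}) :=
  ([ffun j => w (inl j)] : {ffun J -> T}, [ffun k => w (inr k)] : {ffun K -> T}).
exists g.
  by move=> [x y]; congr (_, _); apply/ffunP => i; rewrite !ffunE.
by move=> w; apply/ffunP => -[i|i]; rewrite !ffunE.
Qed.

Lemma subst_cat (J K T : finType) (x : {ffun J -> option T})
    (y : {ffun K -> option T}) t :
  subst (wcat x y) t = wcat (subst x t) (subst y t).
Proof. by apply/ffunP => -[i|i]; rewrite !ffunE. Qed.

(** [fixl x] and [fixr y] are the subspaces of words with left half [x],
    respectively right half [y]. *)
Definition fixl (J K T : finType) (x : {ffun J -> T}) : {ffun J + K -> T + K} :=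
  [ffun i => match i with inl j => inl (x j) | inr k => inr k end].

Definition fixr (J K T : finType) (y : {ffun K -> T}) : {ffun J + K -> T + J} :=
  [ffun i => match i with inl j => inr j | inr k => inl (y k) end].

Lemma app_fixl (J K T : finType) (x : {ffun J -> T}) (y : {ffun K -> T}) :
  app (fixl K x) y = wcat x y.
Proof. by apply/ffunP => -[i|i]; rewrite !ffunE. Qed.

Lemma app_fixr (J K T : finType) (x : {ffun J -> T}) (y : {ffun K -> T}) :
  app (fixr J y) x = wcat x y.
Proof. by apply/ffunP => -[i|i]; rewrite !ffunE. Qed.

Lemma full_fixl (J K T : finType) (x : {ffun J -> T}) : full (fixl K x).
Proof. by apply/fullP => k; exists (inr k); rewrite ffunE. Qed.

Lemma full_fixr (J K T : finType) (y : {ffun K -> T}) : full (fixr J y).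
Proof. by apply/fullP => j; exists (inl j); rewrite ffunE. Qed.

(** The product of a line and an $m$-dimensional subspace; the wildcard of the
    line becomes variable $0$. *)
Definition cons_tpl (J K T : finType) m (L : {ffun J -> option T})
    (s : {ffun K -> T + 'I_m}) : {ffun J + K -> T + 'I_m.+1} :=
  [ffun i => match i with
    | inl j => if L j is Some a then inl a else inr ord0
    | inr k => match s k with inl a => inl a
                            | inr l => inr (lift ord0 l) end
    end].

Definition wtail (T : finType) m (w : {ffun 'I_m.+1 -> T}) : {ffun 'I_m -> T} :=
  [ffun i => w (lift ord0 i)].

Lemma full_cons_tpl (J K T : finType) m (L : {ffun J -> option T})
    (s : {ffun K -> T + 'I_m}) :
  has_None L -> full s -> full (cons_tpl L s).
Proof.
move=> /existsP[i /eqP Li] /fullP fs; apply/fullP => j.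
case: (unliftP ord0 j) => [l ->|->]; last by exists (inl i); rewrite ffunE Li.
by have [k sk] := fs l; exists (inr k); rewrite ffunE sk.
Qed.

Lemma app_cons_tpl (J K T : finType) m (L : {ffun J -> option T})
    (s : {ffun K -> T + 'I_m}) w :
  app (cons_tpl L s) w = wcat (subst L (w ord0)) (app s (wtail w)).
Proof.
apply/ffunP => -[j|k]; rewrite !ffunE; first by case: (L j).
by case: (s k) => // l; rewrite ffunE.
Qed.

Lemma wlift_cons_tpl (J K T : finType) m (L : {ffun J -> option T})
    (s : {ffun K -> T + 'I_m}) :
  wlift (cons_tpl L s) = cons_tpl [ffun j => omap Some (L j)] (wlift s).
Proof.
by apply/ffunP => -[j|k]; rewrite !ffunE; [case: (L j) | case: (s k)].
Qed.

End Templates.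

(** * Ramsey theory *)

Section Ramsey.

Definition HJ_line (T C : finType) : Prop :=
  exists n, forall (I : finType), (n <= #|I|)%N ->
  forall c : {ffun I -> T} -> C, exists2 L : {ffun I -> option T},
    has_None L & forall t t', c (subst L t) = c (subst L t').

Lemma not_inj_pair (n : nat) (C : finType) (f : 'I_n -> C) : (#|C| < n)%N ->
  exists i j : 'I_n, (i < j)%N /\ f i = f j.
Proof.
move=> Cn; have /injectivePn[i [j ij fij]] : ~~ injectiveb f.
  by apply: contraL Cn => /injectiveP/leq_card; rewrite card_ord leqNgt.
case: (ltngtP i j) => [lt|lt|/val_inj eq]; [by exists i, j | by exists j, i |].
by rewrite eq eqxx in ij.
Qed.

(** Among the $|C|+1$ staircase words that are [true] exactly on an initial segment,
    two have the same colour, and they are the two points of a line. *)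
Lemma HJ_line_bool (C : finType) : HJ_line bool C.
Proof.
exists #|C| => I CI c.
pose st (s : 'I_(#|C|).+1) : {ffun I -> bool} := [ffun i => (enum_rank i < s)%N].
have [s [s' [lt eq]]] := @not_inj_pair _ _ (c \o st) (ltnSn _).
pose L : {ffun I -> option bool} := [ffun i =>
  if (enum_rank i < s)%N then Some true
  else if (enum_rank i < s')%N then None else Some false].
have L1 : subst L true = st s'.
  apply/ffunP => i; rewrite !ffunE; case: ltnP => // lts.
    by rewrite (ltn_trans lts lt).
  by case: ifP.
have L0 : subst L false = st s.
  by apply/ffunP => i; rewrite !ffunE; case: ltnP => // lts; case: ifP.
exists L; last by case; case; rewrite ?L1 ?L0 //= -?eq.
have sI : (s < #|I|)%N.
  by apply: leq_trans CI; apply: leq_trans lt _; rewrite -ltnS.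
apply/existsP; exists (enum_val (Ordinal sI)).
by rewrite ffunE enum_valK /= ltnn lt.
Qed.

(** Colour a word [x] of a first block by the whole function that sends a word [y]
    of the second block to the colour of [x] followed by [y]. On a monochromatic line
    the colour depends on [y] alone, which leaves one dimension less to find. *)
Lemma HJ_subspace (T : finType) (t0 : T) : (forall C, HJ_line T C) ->
  forall (C : finType) m, exists n, forall (I : finType), (n <= #|I|)%N ->
  forall c : {ffun I -> T} -> C, exists2 s : {ffun I -> T + 'I_m},
    full s & forall w w', c (app s w) = c (app s w').
Proof.
move=> HJ C; elim=> [|m [p IH]].
  exists 0 => I _ c; exists [ffun=> inl t0]; first by apply/fullP => -[].
  by move=> w w'; congr c; apply/ffunP => i; rewrite !ffunE.
have [q Hq] := HJ {ffun {ffun 'I_p -> T} -> C}.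
exists (q + p)%N => I lqp c.
have [|s0 fs0] := @full_exists I ('I_q + 'I_p)%type T t0.
  by rewrite card_sum !card_ord.
have [|L NL cL] := Hq 'I_q _ (fun x => [ffun y => c (app s0 (wcat x y))]).
  by rewrite card_ord.
have [|s fs cs] := IH 'I_p _ (fun y => c (app s0 (wcat (subst L t0) y))).
  by rewrite card_ord.
exists (tcomp s0 (cons_tpl L s)); first exact/full_comp/full_cons_tpl.
have h w : c (app (tcomp s0 (cons_tpl L s)) w) =
           c (app s0 (wcat (subst L t0) (app s (wtail w)))).
  rewrite app_comp app_cons_tpl.
  by have /ffunP/(_ (app s (wtail w))) := cL (w ord0) t0; rewrite !ffunE.
by move=> w w'; rewrite !h.
Qed.

(** Templates over [bool] with no constant [true] encode disjoint sets
    $S_j$, namely the coordinates that carry variable $j$, and [app] computes the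
    unions of these sets. *)
Definition no_true (I J : finType) (s : {ffun I -> bool + J}) : Prop :=
  forall i, s i <> inl true.

Definition is_min m (w : {ffun 'I_m -> bool}) (j : 'I_m) : Prop :=
  w j /\ forall j' : 'I_m, (j' < j)%N -> ~~ w j'.

Definition clear_true (I J : finType) (s : {ffun I -> bool + J}) :
    {ffun I -> bool + J} :=
  [ffun i => match s i with inl _ => inl false | inr j => inr j end].

(** The first set consists of the new coordinate and of the constants [true] of
    [r]; the others are unions, as [s] prescribes, of the sets of [r]. *)
Definition kill_true (I J : finType) m (r : {ffun I -> bool + J})
    (s : {ffun J -> bool + 'I_m}) : {ffun unit + I -> bool + 'I_m.+1} :=
  [ffun i => match i with
    | inl _ => inr ord0
    | inr i => match r i with
      | inl b => if b then inr ord0 else inl false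
      | inr j => match s j with inl b => inl b
                              | inr l => inr (lift ord0 l) end
      end
    end].

(** Disjoint sets for which the colour of a union depends only on its first member.
    Take a single coordinate as the germ of the first set. Over the words that contain
    it, the Hales-Jewett theorem gives a subspace of one colour; its constant part is
    absorbed by the first set, and the construction goes on among the unions of its
    variable sets, now without the germ. *)
Lemma finite_unions_min (C : finType) (c0 : C) m :
  exists n, forall (I : finType), (n <= #|I|)%N ->
  forall c : {ffun I -> bool} -> C,
  exists (s : {ffun I -> bool + 'I_m}) (g : 'I_m -> C),
    [/\ full s, no_true s &
        forall w j, is_min w j -> c (app s w) = g j].
Proof.
elim: m => [|m [p IH]].
  exists 0 => I _ c; exists [ffun=> inl false], (fun=> c0); split.
  - by apply/fullP => -[].
  - by move=> i; rewrite ffunE.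
  - by move=> w [].
have [q Hq] := HJ_subspace false HJ_line_bool C p.
exists q.+1 => I lq c.
have [e ie] : exists e : unit + 'I_q -> I, injective e.
  by apply: card_inj; rewrite card_sum card_unit card_ord.
pose s0 := extend e [ffun=> false].
have fs0 : full s0 by apply: full_extend.
pose one b : {ffun unit -> bool} := [ffun=> b].
have [|r fr cr] := Hq 'I_q _ (fun y => c (app s0 (wcat (one true) y))).
  by rewrite card_ord.
have [|s [g [fs ns gs]]] := IH 'I_p _
  (fun y => c (app s0 (wcat (one false) (app (clear_true r) y)))).
  by rewrite card_ord.
pose u := kill_true r s.
have fu : full u.
  apply/fullP => j; case: (unliftP ord0 j) => [l ->|->]; last first.
    by exists (inl tt); rewrite ffunE.
  have [j' sj'] := fullP _ fs l; have [i ri] := fullP _ fr j'.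
  by exists (inr i); rewrite ffunE ri sj'.
have nu : no_true u.
  move=> [i|i]; rewrite ffunE //; case: (r i) => [[]|j] //.
  by case sj: (s j) => [b|//] [bt]; apply: (ns j); rewrite sj bt.
exists (tcomp s0 u), (fun j => if unlift ord0 j is Some l then g l else
   c (app s0 (wcat (one true) (app r [ffun=> false])))); split.
- exact: full_comp.
- move=> i; rewrite ffunE /s0 ffunE; case: pickP => [j _|_]; last by rewrite ffunE.
  exact: nu.
move=> w j [wj minj]; rewrite app_comp.
case: (unliftP ord0 j) => [l jl|j0]; last first.
  rewrite -(cr (app s (wtail w))); congr (c (app _ _)).
  rewrite j0 in wj; apply/ffunP => -[i|i]; rewrite !ffunE //.
  by case: (r i) => [[]|j'] //; rewrite ffunE; case: (s j') => // l; rewrite ffunE.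
have w0 : w ord0 = false by apply/negbTE/minj; rewrite jl.
rewrite -(gs (wtail w) l); last first.
  split=> [|l' ll']; rewrite ffunE -?jl //; apply: minj.
  by rewrite jl /= /bump !leq0n !add1n ltnS.
congr (c (app _ _)); apply/ffunP => -[i|i]; rewrite !ffunE //.
by case: (r i) => [[]|j'] //; rewrite ffunE; case: (s j') => // l'; rewrite ffunE.
Qed.

Lemma large_color_class (X C : finType) (c0 : C) (g : X -> C) m :
  (#|C| * m <= #|X|)%N -> exists c1, (m <= #|[pred x | g x == c1]|)%N.
Proof.
move=> CX; apply: contrapT => /forallNP hn.
have mp : (0 < m)%N by rewrite ltnNge; apply/negP => /leq_trans h; apply/(hn c0)/h.
have : (\sum_(c1 : C) #|[pred x | g x == c1]| <= \sum_(c1 : C) m.-1)%N.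
  apply: leq_sum => c1 _; rewrite -ltnS prednK // ltnNge.
  by apply/negP => /hn.
have -> : (\sum_(c1 : C) #|[pred x | g x == c1]|)%N = #|X|.
  rewrite -sum1_card (partition_big g predT) //=.
  by apply: eq_bigr => c1 _; rewrite sum1_card; apply: eq_card.
rewrite sum_nat_const => /(leq_trans CX); rewrite leq_pmul2l.
  by rewrite leqNgt prednK // leqnn.
by apply/card_gt0P; exists c0.
Qed.

(** Folkman's theorem: among many sets as in [finite_unions_min], $m$ of them
    give the same colour as first members, and all unions of these have that colour. *)
Lemma finite_unions (C : finType) m :
  exists n, forall (I : finType), (n <= #|I|)%N ->
  forall c : {ffun I -> bool} -> C,
  exists2 s : {ffun I -> bool + 'I_m}, full s /\ no_true s &
    forall w w' : {ffun 'I_m -> bool}, [exists j, w j] -> [exists j, w' j] ->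
      c (app s w) = c (app s w').
Proof.
case: (pickP (@predT C)) => [c0 _|C0]; last first.
  by exists 0 => I _ c; have := C0 (c [ffun=> false]).
have [n Hn] := finite_unions_min c0 (#|C| * m).
exists n => I nI c; have [s [g [fs ns gs]]] := Hn I nI c.
have [c1 [h [ih gh]]] : exists c1, exists h : 'I_m -> 'I_(#|C| * m),
    injective h /\ forall j, g (h j) = c1.
  have [|c1 hc1] := large_color_class c0 g (m := m); first by rewrite card_ord.
  exists c1.
  have [|h ih] := @card_inj {j | g j == c1} 'I_m.
    by rewrite card_ord card_sig.
  exists (fun j => val (h j)); split=> [j j' /val_inj/ih //|j].
  by apply/eqP/(valP (h j)).
pose r : {ffun 'I_(#|C| * m) -> bool + 'I_m} := extend h [ffun=> false].
have fr : full r by apply: full_extend.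
exists (tcomp s r).
  split; first exact: full_comp.
  move=> i; rewrite ffunE; case si: (s i) => [b|j].
    by move=> [bt]; apply: (ns i); rewrite si bt.
  by rewrite ffunE; case: pickP => // _; rewrite ffunE.
suff hw (w : {ffun 'I_m -> bool}) : [exists j, w j] -> c (app (tcomp s r) w) = c1.
  by move=> w w' /hw -> /hw ->.
case/existsP=> j wj; rewrite app_comp.
have vj : app r w (h j) by rewrite ffunE extend_in.
have [k vk mink] := arg_minnP val vj.
have rk : is_min (app r w) k.
  by split=> // k' lt; apply: contraL lt => /mink; rewrite -leqNgt.
rewrite (gs _ _ rk); move: vk; rewrite ffunE /r ffunE.
by case: pickP => [j' /eqP <-|_]; rewrite ?ffunE.
Qed.

Definition same_None (I T : finType) (x y : {ffun I -> option T}) : Prop :=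
  forall i, (x i == None) = (y i == None).

(** Block by block, pass to a line over [T] on which moving from one letter of [T]
    to another never changes the colour, whatever follows. Then a letter matters only
    through its being [None] or not. *)
Lemma same_None_color (T : finType) (t0 : T) : (forall C, HJ_line T C) ->
  forall m (C : finType), exists n, forall (I : finType), (n <= #|I|)%N ->
  forall c : {ffun I -> option T} -> C,
  exists2 s : {ffun I -> T + 'I_m}, full s &
    forall x y, same_None x y -> c (app (wlift s) x) = c (app (wlift s) y).
Proof.
move=> HJ; elim=> [|m IH] C.
  exists 0 => I _ c; exists [ffun=> inl t0]; first by apply/fullP => -[].
  by move=> x y _; congr (c (app _ _)); apply/ffunP => -[].
have [p Hp] := IH (C * C)%type.
have [q Hq] := HJ {ffun {ffun 'I_p -> option T} -> C}.
exists (q + p)%N => I lqp c.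
have [|s0 fs0] := @full_exists I ('I_q + 'I_p)%type T t0.
  by rewrite card_sum !card_ord.
pose c' x y := c (app (wlift s0) (wcat x y)).
have [|L NL cL] := Hq 'I_q _ (fun x => [ffun y => c' (wsome x) y]).
  by rewrite card_ord.
have [|s fs cs] := Hp 'I_p _ (fun y => (c' L y, c' (wsome (subst L t0)) y)).
  by rewrite card_ord.
exists (tcomp s0 (cons_tpl L s)); first exact/full_comp/full_cons_tpl.
pose l0 (o : option T) := if o is Some _ then wsome (subst L t0) else L.
have h x : c (app (wlift (tcomp s0 (cons_tpl L s))) x) =
           c' (l0 (x ord0)) (app (wlift s) (wtail x)).
  rewrite wlift_comp app_comp wlift_cons_tpl app_cons_tpl.
  rewrite -[LHS]/(c' _ (app (wlift s) (wtail x))).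
  case: (x ord0) => [a|] /=.
    have /ffunP/(_ (app (wlift s) (wtail x))) := cL a t0; rewrite !ffunE => <-.
    by congr (c' _ _); apply/ffunP => i; rewrite !ffunE; case: (L i).
  by congr (c' _ _); apply/ffunP => i; rewrite !ffunE; case: (L i).
move=> x y xy; rewrite !h.
have xy' : same_None (wtail x) (wtail y) by move=> i; rewrite !ffunE.
have [h1 h2] := cs _ _ xy'.
by have := xy ord0; case: (x ord0); case: (y ord0).
Qed.

(** The Graham-Rothschild theorem for lines. Once the colour of a line depends only
    on its set of wildcards, this is a statement about unions of disjoint sets. *)
Lemma graham_rothschild (T : finType) (t0 : T) : (forall C, HJ_line T C) ->
  forall m (C : finType), exists n, forall (I : finType), (n <= #|I|)%N ->
  forall c : {ffun I -> option T} -> C,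
  exists2 s : {ffun I -> T + 'I_m}, full s &
    forall x y, has_None x -> has_None y ->
      c (app (wlift s) x) = c (app (wlift s) y).
Proof.
move=> HJ m C; have [p Hp] := finite_unions C m.
have [n Hn] := same_None_color t0 HJ p C; exists n => I nI c.
have [s fs cs] := Hn I nI c.
pose wd (b : {ffun 'I_p -> bool}) : {ffun 'I_p -> option T} :=
  [ffun i => if b i then None else Some t0].
have [|u [fu nu] cu] := Hp 'I_p _ (fun b => c (app (wlift s) (wd b))).
  by rewrite card_ord.
pose v : {ffun 'I_p -> T + 'I_m} :=
  [ffun i => match u i with inl _ => inl t0 | inr j => inr j end].
have fv : full v.
  by apply/fullP => j; have [i ui] := fullP _ fu j; exists i; rewrite ffunE ui.
exists (tcomp s v); first exact: full_comp.
pose nb (x : {ffun 'I_m -> option T}) : {ffun 'I_m -> bool} :=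
  [ffun j => x j == None].
have h x : c (app (wlift (tcomp s v)) x) = c (app (wlift s) (wd (app u (nb x)))).
  rewrite wlift_comp app_comp; apply: cs => i; rewrite !ffunE.
  case ui: (u i) => [[]|j] //; first by have := nu i.
  by rewrite !ffunE; case: (x j).
move=> x y /existsP[j xj] /existsP[j' yj']; rewrite !h; apply: cu.
  by apply/existsP; exists j; rewrite ffunE.
by apply/existsP; exists j'; rewrite ffunE.
Qed.

End Ramsey.

(** * Dense sets of words *)

Section Density.
Variable R : realType.
Implicit Types (I T C : finType) (delta eps : R).

Definition DHJ T : Prop := forall delta, 0 < delta ->
  exists n, forall I, (n <= #|I|)%N ->
  forall A : pred {ffun I -> T}, delta <= mu R A -> has_line A.

Definition DHJ_subspace T m : Prop := forall delta, 0 < delta ->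
  exists n, forall I, (n <= #|I|)%N ->
  forall A : pred {ffun I -> T}, delta <= mu R A ->
  exists2 s : {ffun I -> T + 'I_m}, full s & forall w, A (app s w).

Lemma dense_extend I (J T : finType) (t0 : T) (e : J -> I)
    (A : pred {ffun I -> T}) (delta : R) : injective e -> delta <= mu R A ->
  exists y, delta <= mu R (fun w => A (app (extend e y) w)).
Proof.
move=> ie; rewrite /mu (avg_extend t0 _ ie).
exact: (le_avg_ex ([ffun=> t0] : {ffun I -> T})).
Qed.

Lemma mu_cat (J K T : finType) (A : pred {ffun J + K -> T}) :
  mu R A = avg (fun y => mu R (fun x => A (wcat x y))).
Proof. by rewrite /mu avg_cat avg_exchange. Qed.

Lemma DHJ_coloring T (t0 : T) : DHJ T -> forall C, HJ_line T C.
Proof.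
move=> hT C; case: (pickP (@predT C)) => [c0 _|C0]; last first.
  by exists 0%N => I _ c; have := C0 (c [ffun=> t0]).
have Cp : 0 < (#|C|%:R)^-1 :> R.
  by rewrite invr_gt0 ltr0n; apply/card_gt0P; exists c0.
have [n Hn] := hT _ Cp; exists n => I nI c.
have [|x _|c1] := @mu_pigeonhole R _ C (fun _ : {ffun I -> T} => true)
   (fun x => pred1 (c x)).
- by rewrite (mu_predT R [ffun=> t0]) ltr01.
- by exists (c x) => /=.
rewrite (mu_predT R [ffun=> t0]) mul1r => /(Hn I nI)[L NL cL].
by exists L => // t t'; rewrite -(eqP (cL t)) -(eqP (cL t')).
Qed.

(** Most sections along a first block are dense and contain a line. A popular line
    is common to a dense set of sections, in which a subspace of one dimension less
    is found by induction. *)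
Lemma DHJ_to_subspace T (t0 : T) : DHJ T -> forall m, DHJ_subspace T m.
Proof.
move=> hT; elim=> [|m IH] delta d0.
  exists 0%N => I _ A dA.
  have [x Ax] : exists x, A x.
    apply: contrapT => /forallNP nA; move: dA; rewrite leNgt => /negP; apply.
    by rewrite /mu /avg big1 ?mul0r // => x _; case: (boolP (A x)) => // /nA.
  exists [ffun i => inl (x i)]; first by apply/fullP => -[].
  by move=> w; rewrite (_ : app _ _ = x) //; apply/ffunP => i; rewrite !ffunE.
have d2 : 0 < delta / 2 by rewrite divr_gt0.
have [q Hq] := hT _ d2.
pose La := #|{ffun 'I_q -> option T}|.
have La0 : 0 < La%:R :> R.
  by rewrite ltr0n; apply/card_gt0P; exists [ffun=> None].
have [|p Hp] := IH (delta / 2 / La%:R); first by rewrite divr_gt0.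
exists (q + p)%N => I lqp A dA.
have [|e ie] := @card_inj I ('I_q + 'I_p)%type; first by rewrite card_sum !card_ord.
have [y0 {}dA] := dense_extend t0 ie dA; set s0 := extend e y0 in dA.
pose P y := delta / 2 <= mu R (fun x => A (app s0 (wcat x y))).
have dP : delta / 2 <= mu R P.
  have := @avg_le_mu R _ ([ffun=> t0] : {ffun 'I_p -> T})
     (fun y => mu R (fun x => A (app s0 (wcat x y)))) (delta / 2) (ltW d2)
     (fun _ => mu_le1 _ _).
  rewrite -(mu_cat (fun w => A (app s0 w))) -/P; lra.
pose Q y (L : {ffun 'I_q -> option T}) :=
  has_None L && [forall t, A (app s0 (wcat (subst L t) y))].
have [||L] := @mu_pigeonhole R _ _ P Q; first exact: lt_le_trans dP.
  move=> y Py; have [|L NL AL] := Hq 'I_q _ _ Py; first by rewrite card_ord.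
  by exists L; rewrite /Q NL; apply/forallP.
rewrite -/La => dL.
have {}dL : delta / 2 / La%:R <= mu R (Q^~ L).
  by apply: le_trans dL; rewrite ler_pM2r ?invr_gt0.
have [|s fs As] := Hp 'I_p _ _ dL; first by rewrite card_ord.
have /andP[NL _] := As [ffun=> t0].
exists (tcomp s0 (cons_tpl L s)) => [|w].
  by apply/full_comp/full_cons_tpl => //; apply: full_extend.
by rewrite app_comp app_cons_tpl; have /andP[_ /forallP] := As (wtail w); apply.
Qed.

(** The density is exactly [q ^+ #|I|], where [q] is the proportion of letters
    other than [None]. *)
Lemma mu_no_None_small T (eps : R) : 0 < eps -> exists n, forall I, (n <= #|I|)%N ->
  mu R (fun z : {ffun I -> option T} => ~~ has_None z) <= eps.
Proof.
pose g (o : option T) : R := (o != None)%:R => e0.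
have g0 o : 0 <= g o by rewrite ler0n.
have g1 : avg g < 1.
  by apply: (@avg_lt1 _ _ _ None) => [o|]; rewrite /g /= ?ltr01 ?lern1 ?leq_b1.
have [|n Hn] := @expr_small R (avg g) eps _ e0; first by rewrite avg_ge0.
exists n => I /Hn; rewrite -avg_prod; apply: le_trans; apply: le_avg => z.
case: (boolP (has_None z)) => [_|/existsPn h]; first by rewrite prodr_ge0.
by rewrite big1 // => i _; rewrite /g h.
Qed.

Definition nsome I T (z : {ffun I -> option T}) : nat :=
  #|[pred i | z i != None]|.

(** Markov's inequality for the variable [2^-1 ^+ nsome z], a product of
    independent factors whose average is less than $1$. *)
Lemma mu_few_Some_small T (t0 : T) N (eps : R) : 0 < eps ->
  exists n, forall I, (n <= #|I|)%N ->
  mu R (fun z : {ffun I -> option T} => (nsome z < N)%N) <= eps.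
Proof.
(* The average of [\prod_i g (z i)] is [avg g ^+ #|I|], and the product is at least
   [2 ^- N] when fewer than [N] letters differ from [None]. *)
pose g (o : option T) : R := if o is None then 1 else 2^-1 => e0.
have g0 o : 0 <= g o by rewrite /g; case: o => // _; lra.
have g1 : avg g < 1.
  by apply: (@avg_lt1 _ _ _ (Some t0)) => [[o|]|]; rewrite /g; lra.
have [||n Hn] := @expr_small R (avg g) (eps / 2 ^+ N).
- by rewrite avg_ge0.
- by rewrite divr_gt0 // exprn_gt0.
exists n => I /Hn; rewrite -avg_prod ler_pdivlMr ?exprn_gt0 // mulrC -avgZ.
apply: le_trans; apply: le_avg => z.
have -> : \prod_i g (z i) = 2^-1 ^+ nsome z.
  rewrite (bigID [pred i | z i == None]) /= big1 ?mul1r; last first.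
    by move=> i /eqP ->.
  rewrite (eq_bigr (fun=> 2^-1)); last by move=> i; rewrite /g; case: (z i).
  by rewrite prodr_const.
case: ltnP => [/ltnW lt|_]; last first.
  by rewrite mulr_ge0 ?exprn_ge0 //; lra.
by rewrite exprVn ler_pdivlMr ?exprn_gt0 // mul1r ler_weXn2l //; lra.
Qed.

(** Membership is unchanged when letters [None] and [Some t] are exchanged for one
    another. *)
Definition insens I T (t : T) (D : pred {ffun I -> option T}) : Prop :=
  forall x y, subst x t = subst y t -> D x = D y.

Definition mix I T (z : {ffun I -> option T}) (x : {ffun I -> T}) :
  {ffun I -> option T} := [ffun i => if z i is Some _ then Some (x i) else None].

(** A random word over [option T] arises from a random set of positions for [None]
    and an independent random word over [T]. As in [avg_extend], the map that swaps
    the two letters of [T] competing for a coordinate is an involution. *)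
Lemma avg_mix I T (t0 : T) (f : {ffun I -> option T} -> R) :
  avg f = avg (fun z => avg (fun x => f (mix z x))).
Proof.
pose h (p : {ffun I -> option T} * {ffun I -> T}) :=
  (mix p.1 p.2, [ffun i => odflt (p.2 i) (p.1 i)] : {ffun I -> T}).
have hK : involutive h.
  move=> [z x]; congr (_, _); apply/ffunP => i; rewrite !ffunE /= ?ffunE /=;
    by case: (z i) => //= a; rewrite ?ffunE.
rewrite (avg_pair (fun z x => f (mix z x))).
rewrite -(avg_fst ([ffun=> t0] : {ffun I -> T}) f).
rewrite -(avg_bij _ (inv_bij hK)).
by apply: eq_avg => -[z x].
Qed.

(** Fix the positions of [None] so that the words over [T] on the remaining
    coordinates still meet [D] in a dense set. This set contains a subspace over [T],
    and by insensitivity the variables of the subspace may take the value [None] as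
    well. *)
Lemma insens_subspace T (t0 : T) : DHJ T -> forall m (eps : R), 0 < eps ->
  exists n, forall I, (n <= #|I|)%N ->
  forall (t : T) (D : pred {ffun I -> option T}), insens t D -> eps <= mu R D ->
  exists2 s : {ffun I -> option T + 'I_m}, full s & forall w, D (app s w).
Proof.
move=> hT m eps e0.
have e3 : 0 < eps / 3 by rewrite divr_gt0.
have [N HN] := DHJ_to_subspace t0 hT m e3.
have [n Hn] := mu_few_Some_small t0 N e3.
exists n => I /Hn few t D iD dD.
have [z Nz dz] : exists2 z : {ffun I -> option T}, (N <= nsome z)%N &
    eps / 3 <= mu R (fun x => D (mix z x)).
  pose g z := mu R (fun x => D (mix z x)).
  have h : eps - eps / 3 <= mu R (fun z => eps / 3 <= g z).
    have := @avg_le_mu R _ ([ffun=> None] : {ffun I -> option T}) g (eps / 3)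
      (ltW e3) (fun _ => mu_le1 _ _).
    have -> : avg g = mu R D by rewrite [RHS](avg_mix t0).
    by lra.
  have h2 : eps - eps / 3 <= mu R (fun z : {ffun I -> option T} => (nsome z < N)%N)
     + mu R (fun z => (eps / 3 <= g z) && (N <= nsome z)%N).
    apply: (le_trans h); rewrite -avgD; apply: le_avg => z.
    by case: (_ <= g z); case: ltnP => /= _; rewrite ?addr0 ?add0r ?ler01 // ler0n.
  apply: contrapT => hz; suff : mu R (fun z => (eps / 3 <= g z) && (N <= nsome z)%N) = 0.
    by lra.
  rewrite /mu /avg big1 ?mul0r // => z _; case: andP => // -[h3 h4].
  by case: hz; exists z.
(* The coordinates [e j] avoid the positions of [None] in [z]. *)
have [e' ie'] : exists e : 'I_N -> {i | z i != None}, injective e.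
  by apply: card_inj; rewrite card_ord card_sig.
pose e j := val (e' j).
have ie : injective e by move=> j j' /val_inj/ie'.
have ze j : z (e j) != None := valP (e' j).
have [y dy] := dense_extend t0 ie dz.
have [|u fu Du] := HN 'I_N _ _ dy; first by rewrite card_ord.
(* The variables of [r] sit at coordinates where [z] differs from [None]. *)
pose r := tcomp (extend e y) u.
have fr : full r by apply: full_comp => //; apply: full_extend.
have zr i j : r i = inr j -> z i != None.
  by rewrite !ffunE; case: pickP => // k /eqP <-.
pose s : {ffun I -> option T + 'I_m} :=
  [ffun i => if z i is None then inl None else wlift r i].
exists s.
  apply/fullP => j; have [i ri] := fullP _ fr j; exists i.
  by rewrite ffunE; have := zr _ _ ri; case: (z i) => // a _; rewrite ffunE ri.
move=> w; rewrite (@iD _ (mix z (app r (subst w t)))).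
  by rewrite app_comp.
apply/ffunP => i; rewrite !ffunE.
case: (z i) => //= a; case: pickP => [j _|_] //=.
by case: (u j) => //= k; rewrite ffunE.
Qed.

End Density.

(** * Insensitive sets and subspaces *)

Section Tiling.
Variable R : realType.
Implicit Types (I J K T : finType).

Lemma insens_app I J T t (s : {ffun I -> option T + J})
    (D : pred {ffun I -> option T}) :
  insens t D -> insens t (fun w => D (app s w)).
Proof.
move=> iD x y /ffunP xy; apply: iD; apply/ffunP => i; rewrite !ffunE.
by case: (s i) => // j; have := xy j; rewrite !ffunE.
Qed.

(** A choice that depends on the set [E] alone. This is what keeps the remainders
    insensitive in [avg_insens_step]: two sections that are equal as sets lose
    the same subspace. *)
Definition subspace_in I T m (E : {set {ffun I -> T}}) : {set {ffun I -> T}} :=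
  if [pick s : {ffun I -> T + 'I_m} | full s & [forall w, app s w \in E]]
    is Some s then [set app s w | w in [set: {ffun 'I_m -> T}]] else set0.

Lemma subspace_in_sub I T m (E : {set {ffun I -> T}}) :
  {subset subspace_in m E <= E}.
Proof.
move=> x; rewrite /subspace_in; case: pickP => [s|_]; last by rewrite in_set0.
by case/andP=> _ /forallP h /imsetP[w _ ->].
Qed.

Lemma avg_subspace_in I T m (t0 : T) (E : {set {ffun I -> T}}) (f : {ffun I -> T} -> R) :
  (forall s : {ffun I -> T + 'I_m}, full s -> avg (fun w => f (app s w)) <= 0) ->
  avg (fun x => f x * (x \in subspace_in m E)%:R) <= 0.
Proof.
move=> hf; rewrite /avg; apply: mulr_le0_ge0; last by rewrite invr_ge0 ler0n.
rewrite (eq_bigr (fun x => if x \in subspace_in m E then f x else 0)); last first.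
  by move=> x _; case: (x \in _); rewrite ?mulr1 ?mulr0.
rewrite -big_mkcond /subspace_in; case: pickP => [s /andP[fs _]|_] /=; last first.
  by rewrite big_set0.
rewrite big_imset /=; last by move=> w w' _ _; apply: app_inj.
have := hf s fs; rewrite /avg.
have Tp : 0 < #|{ffun 'I_m -> T}|%:R :> R.
  by rewrite ltr0n; apply/card_gt0P; exists [ffun=> t0].
by rewrite pmulr_lle0 ?invr_gt0 // (eq_bigl predT) // => w; rewrite in_setT.
Qed.

Lemma mu_subspace_in I T m (t0 : T) (E : {set {ffun I -> T}}) :
  (exists2 s : {ffun I -> T + 'I_m}, full s & forall w, app s w \in E) ->
  (#|{ffun I -> T}|%:R)^-1 <= mu R [pred x in subspace_in m E].
Proof.
move=> [s fs sE].
have [x xV] : exists x, x \in subspace_in m E.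
  rewrite /subspace_in; case: pickP => [u _|/(_ s)].
    by exists (app u [ffun=> t0]); apply: imset_f; rewrite in_setT.
  by rewrite fs /= => /forallP; case.
have Tp : 0 < #|{ffun I -> T}|%:R :> R by rewrite ltr0n; apply/card_gt0P; exists x.
rewrite -[_^-1]mul1r ler_pdivrMr // mulrC.
have := @le_card_avg R _ (fun x => ([pred x in subspace_in m E] x)%:R : R) x.
by rewrite /= xV; apply=> y; rewrite ler0n.
Qed.

(** In the applications [f] is an indicator function minus a constant, and the
    condition says that no [m]-dimensional subspace is denser than that constant. *)
Definition subspace_npos I T m (f : {ffun I -> T} -> R) : Prop :=
  forall s : {ffun I -> T + 'I_m}, full s -> avg (fun w => f (app s w)) <= 0.

Lemma subspace_npos_app I J T m (s : {ffun I -> T + J}) f :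
  full s -> subspace_npos m f -> subspace_npos m (fun w => f (app s w)).
Proof.
move=> fs hf u fu; under eq_avg do rewrite -app_comp.
by apply: hf; apply: full_comp.
Qed.

(** An insensitive set is, up to a small error, a disjoint union of subspaces. Split
    off a block of bounded length. By [insens_subspace] a section of density at least
    [eps] along it contains a subspace, on which [f] has nonpositive average. Removing
    these subspaces lowers the density in excess of [eps] by the factor [1 - c], where
    [1 / c] is the number of words on the block, and what remains is still insensitive
    in the coordinates of the other block. The estimate is affine in the density of
    [D], so it survives averaging over sections. *)
Lemma avg_insens_step T (t0 : T) : DHJ R T -> forall m (eps : R), 0 < eps ->
  exists2 c : R, 0 < c <= 1 & forall k, exists n, forall I, (n <= #|I|)%N ->
  forall (t : T) (D : pred {ffun I -> option T}), insens t D ->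
  forall f : {ffun I -> option T} -> R, (forall x, f x <= 1) ->
  subspace_npos m f ->
  avg (fun x => f x * (D x)%:R) <= eps + (1 - c) ^+ k * (mu R D - eps).
Proof.
move=> hT m eps e0; have [N HN] := insens_subspace t0 hT m e0.
pose W := {ffun 'I_N -> option T}.
have W0 : (0 < #|{: W}|)%N by apply/card_gt0P; exists [ffun=> None].
pose c : R := (#|{: W}|%:R)^-1.
have c0 : 0 < c by rewrite invr_gt0 ltr0n.
have c1 : c <= 1 by rewrite invf_le1 ?ltr0n // ler1n.
exists c => [|k]; first by rewrite c0.
elim: k => [|k [p IH]].
  exists 0%N => I _ t D _ f f1 _; rewrite expr0 mul1r addrC subrK.
  by apply: le_avg => x; case: (D x); rewrite ?mulr1 ?mulr0.
exists (N + p)%N => I NpI t D iD f f1 hf.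
have [e ie] : exists e : 'I_N + 'I_p -> I, injective e.
  by apply: card_inj; rewrite card_sum !card_ord.
set q := 1 - c.
have q0 : 0 <= q by rewrite subr_ge0.
rewrite /mu (avg_extend None (fun x => f x * _) ie).
rewrite (avg_extend None (fun x => (D x)%:R) ie).
pose y0 : {ffun I -> option T} := [ffun=> None].
rewrite -(avg_affine y0).
apply: le_avg => y; rewrite -[avg (fun w => (D _)%:R)]/(mu R (fun w => _)).
set s0 := extend e y; have fs0 : full s0 by apply: full_extend.
pose g w := f (app s0 w); pose B w := D (app s0 w).
have iB : insens t B by apply: insens_app.
have g1 w : g w <= 1 by apply: f1.
have hg : subspace_npos m g by apply: subspace_npos_app.
rewrite -/g -/B {iD f1 hf}.
pose V (y : {ffun 'I_p -> option T}) := subspace_in m [set x : W | B (wcat x y)].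
have VB x z : x \in V z -> B (wcat x z) by move/subspace_in_sub; rewrite inE.
(* [V z] is the subspace removed from the section at [z], and [D2] is what remains. *)
pose D2 x z := B (wcat x z) && (x \notin V z).
have -> : avg (fun w => g w * (B w)%:R) =
    avg (fun z => avg (fun x => g (wcat x z) * (x \in V z)%:R)) +
    avg (fun x => avg (fun z => g (wcat x z) * (D2 x z)%:R)).
  rewrite avg_cat [X in _ = X + _]avg_exchange -avgD; apply: eq_avg => x.
  rewrite -avgD; apply: eq_avg => z; rewrite -mulrDr; congr (_ * _).
  rewrite /D2; have := VB x z; case: (x \in V z) => /= [->|_] //.
    by rewrite addr0.
  by rewrite andbT add0r.
have h1 : avg (fun z => avg (fun x => g (wcat x z) * (x \in V z)%:R)) <= 0.
  rewrite -(avg_cst ([ffun=> None] : {ffun 'I_p -> option T}) 0).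
  apply: le_avg => z; apply: (avg_subspace_in None) => s fs.
  have := subspace_npos_app (full_fixr _ z) hg fs.
  by under eq_avg do rewrite app_fixr.
have h2 : avg (fun x => avg (fun z => g (wcat x z) * (D2 x z)%:R)) <=
    eps + q ^+ k * (avg (fun x => mu R (D2 x)) - eps).
  pose x0 : W := [ffun=> None].
  rewrite -(avg_affine x0).
  apply: le_avg => x; apply: (IH _ _ t).
  - by rewrite card_ord.
  - move=> z z' zz'; rewrite /D2 /V.
    have Bzz x' : B (wcat x' z) = B (wcat x' z').
      by apply: iB; rewrite !subst_cat zz'.
    rewrite Bzz; congr (_ && (_ \notin subspace_in m _)).
    by apply/setP => x'; rewrite !inE.
  - by move=> z; apply: g1.
  move=> s fs; have := subspace_npos_app (full_fixl _ x) hg fs.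
  by under eq_avg do rewrite app_fixl.
have h3 : avg (fun x => mu R (D2 x)) = mu R B - avg (fun z => mu R [pred x in V z]).
  rewrite {2}/mu avg_cat [X in _ = _ - X]avg_exchange -avgB; apply: eq_avg => x.
  rewrite -avgB; apply: eq_avg => z /=.
  rewrite /D2; have := VB x z; case: (x \in V z) => /= [->|_] //=.
    by rewrite subrr.
  by rewrite andbT subr0.
(* A proportion of at least [mu R B - eps] of the sections loses a subspace, and a
   nonempty set has density at least [c]. *)
have h4 : c * (mu R B - eps) <= avg (fun z => mu R [pred x in V z]).
  have := @avg_le_mu R _ ([ffun=> None] : {ffun 'I_p -> option T})
    (fun z => mu R (fun x => B (wcat x z))) eps (ltW e0) (fun _ => mu_le1 _ _).
  rewrite -mu_cat -lerBlDr => h.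
  apply: le_trans (_ : c * mu R (fun z => eps <= mu R (fun x => B (wcat x z))) <= _).
    by rewrite ler_pM2l.
  rewrite -avgZ; apply: le_avg => z;
  case: (leP eps (mu R (fun x => B (wcat x z)))) => [hz|_]; last first.
    by rewrite mulr0 mu_ge0.
  rewrite mulr1; apply: (mu_subspace_in None).
  have [||s fs hs] := HN 'I_N _ t (fun x => B (wcat x z)) _ hz.
  - by rewrite card_ord.
  - by move=> x x' xx'; apply: iB; rewrite !subst_cat xx'.
  by exists s => // w; rewrite inE.
have qk : 0 <= q ^+ k by rewrite exprn_ge0.
apply: le_trans (lerD h1 h2) _; rewrite add0r lerD2l exprSr -mulrA.
rewrite ler_wpM2l // h3 /q; lra.
Qed.

Lemma avg_insens_le T (t0 : T) : DHJ R T -> forall m (eps : R), 0 < eps ->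
  exists n, forall I, (n <= #|I|)%N ->
  forall (t : T) (D : pred {ffun I -> option T}), insens t D ->
  forall f : {ffun I -> option T} -> R, (forall x, f x <= 1) ->
  subspace_npos m f -> avg (fun x => f x * (D x)%:R) <= eps.
Proof.
move=> hT m eps e0; have e2 : 0 < eps / 2 by rewrite divr_gt0.
have [c /andP[c0 c1] hc] := avg_insens_step t0 hT m e2.
have [|k hk] := @expr_small R (1 - c) (eps / 2) _ e2.
  by rewrite subr_ge0 c1 gtrBl.
have [n Hn] := hc k; exists n => I nI t D iD f f1 hf.
apply: le_trans (Hn I nI t D iD f f1 hf) _.
have := hk k (leqnn _); have : 0 <= (1 - c) ^+ k by rewrite exprn_ge0 // subr_ge0.
have := mu_le1 R D; set Q := _ ^+ k; set M := mu R D; nra.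
Qed.

(** On each subspace used for the first set, the intersection with the other sets
    is again an intersection of insensitive sets, hence covered by the induction. *)
Lemma avg_inter_insens_le T (t0 : T) :
  DHJ R T -> forall (ts : seq T) m (eps : R), 0 < eps ->
  exists n, forall I, (n <= #|I|)%N ->
  forall D : T -> pred {ffun I -> option T}, (forall t, insens t (D t)) ->
  forall f : {ffun I -> option T} -> R, (forall x, f x <= 1) ->
  subspace_npos m f -> avg (fun x => f x * (all (D^~ x) ts)%:R) <= eps.
Proof.
move=> hT; elim=> [|t ts IH] m eps e0.
  exists m => I mI D _ f f1 hf; apply: le_trans (ltW e0).
  have [e ie] : exists e : 'I_m -> I, injective e by apply: card_inj; rewrite card_ord.
  under eq_avg do rewrite /= mulr1.
  rewrite (avg_extend None _ ie) -(avg_cst ([ffun=> None] : {ffun I -> option T}) 0).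
  by apply: le_avg => y; apply/hf/full_extend.
have e2 : 0 < eps / 2 by rewrite divr_gt0.
have [p Hp] := IH m _ e2; have [n Hn] := avg_insens_le t0 hT p e2.
exists n => I nI D iD f f1 hf.
(* Subtracting the error of the induction hypothesis makes the averages of [g] on
   [p]-dimensional subspaces nonpositive. *)
pose g x := f x * (all (D^~ x) ts)%:R - eps / 2.
have g1 x : g x <= 1.
  by have := f1 x; rewrite /g; case: all; rewrite ?mulr1 ?mulr0; lra.
have hg : subspace_npos p g.
  move=> s fs; rewrite avgB (avg_cst [ffun=> None]) subr_le0.
  apply: (Hp 'I_p _ (fun t w => D t (app s w))).
  - by rewrite card_ord.
  - by move=> t'; apply: insens_app.
  - by move=> x.
  exact: subspace_npos_app.
have := Hn I nI t (D t) (iD t) g g1 hg.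
rewrite /g; under eq_avg do rewrite mulrBl.
rewrite avgB avgZ -[avg (fun x => (D t x)%:R)]/(mu R (D t)) => h.
have -> : avg (fun x => f x * (all (D^~ x) (t :: ts))%:R) =
          avg (fun x => f x * (all (D^~ x) ts)%:R * (D t x)%:R).
  by apply: eq_avg => x; rewrite -mulrA -natrM mulnb andbC.
have := mu_le1 R (D t); nra.
Qed.

(** The complement of the intersection is the disjoint union, over the proper subsets
    [Q] of [T], of the sets of points [x] for which [Q] is the set of all [t] with
    [D t x]. Complements of insensitive sets are insensitive, so [avg_inter_insens_le]
    applies to each. *)
Lemma avg_compl_insens_le T (t0 : T) : DHJ R T -> forall m (eps : R), 0 < eps ->
  exists n, forall I, (n <= #|I|)%N ->
  forall D : T -> pred {ffun I -> option T}, (forall t, insens t (D t)) ->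
  forall f : {ffun I -> option T} -> R, (forall x, f x <= 1) ->
  subspace_npos m f -> avg (fun x => f x * (~~ [forall t, D t x])%:R) <= eps.
Proof.
move=> hT m eps e0; pose M := #|{set T}|.
have M0 : 0 < M%:R :> R by rewrite ltr0n; apply/card_gt0P; exists set0.
have eM : 0 < eps / M%:R by rewrite divr_gt0.
have [n Hn] := avg_inter_insens_le t0 hT (enum T) m eM.
exists n => I nI D iD f f1 hf.
pose DQ (Q : {set T}) t x := D t x == (t \in Q).
have DQE Q x : all (DQ Q ^~ x) (enum T) = (Q == [set t | D t x]).
  apply/allP/eqP => [h|-> t _]; last by rewrite /DQ inE eqxx.
  by apply/setP => t; rewrite inE; apply/esym/eqP/h; rewrite mem_enum.
have hQ Q : avg (fun x => f x * (Q == [set t | D t x])%:R) <= eps / M%:R.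
  under eq_avg do rewrite -DQE.
  by apply: Hn => // t x y xy; rewrite /DQ (iD t x y xy).
have -> : avg (fun x => f x * (~~ [forall t, D t x])%:R) =
    \sum_(Q | Q != setT) avg (fun x => f x * (Q == [set t | D t x])%:R).
  rewrite /avg -mulr_suml exchange_big /=; congr (_ / _); apply: eq_bigr => x _.
  rewrite -mulr_sumr; congr (_ * _).
  have [/forallP h|h] := boolP [forall t, D t x].
    rewrite big1 // => Q QT; rewrite (_ : [set t | D t x] = setT).
      by rewrite (negbTE QT).
    by apply/setP => t; rewrite !inE h.
  have pT : [set t | D t x] != setT.
    by apply: contra h => /eqP/setP h; apply/forallP => t; have := h t; rewrite !inE.
  rewrite (bigD1 [set t | D t x] pT) /= eqxx big1 ?addr0 // => Q /andP[_ nQ].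
  by rewrite (negbTE nQ).
apply: le_trans (_ : \sum_(Q : {set T}) eps / M%:R <= _); last first.
  by rewrite sumr_const -/M -[_ *+ M]mulr_natr mulfVK // gt_eqF.
rewrite [leRHS](bigID (fun Q => Q != setT)) /= ler_wpDr //.
  by apply: sumr_ge0 => Q _; apply: ltW.
by apply: ler_sum => Q _.
Qed.

End Tiling.

(** * The density Hales-Jewett theorem *)

Section DHJ.
Variable R : realType.
Implicit Types (I J K T : finType).

Definition dense_line T (d : R) : Prop :=
  exists n, forall I, (n <= #|I|)%N ->
  forall A : pred {ffun I -> T}, d <= mu R A -> has_line A.

(** The infimum of the densities that force a line. Just below it there are
    line-free sets in arbitrarily high dimension; these cannot have increased density
    on any large subspace, by the choice of the infimum. *)
Lemma line_threshold T : ~ DHJ R T ->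
  exists2 d : R, 0 < d <= 2 &
    (forall eta, 0 < eta -> dense_line T (d + eta)) /\
    (forall eta, 0 < eta < d -> ~ dense_line T (d - eta)).
Proof.
move=> nT.
have [d1 d10 nd1] : exists2 d1, 0 < d1 & ~ dense_line T d1.
  by apply: contrapT => h; apply: nT => d d0; apply: contrapT => nd; apply: h; exists d.
have mono a b : a <= b -> dense_line T a -> dense_line T b.
  move=> ab [n Hn]; exists n => I nI A bA; apply: Hn => //.
  exact: le_trans bA.
pose E : classical_sets.set R := fun d => 0 < d /\ dense_line T d.
have E2 : E 2.
  split=> //; exists 0%N => I _ A dA; have := mu_le1 R A; lra.
have lbE : classical_sets.lbound E d1.
  move=> d [d0 hd]; rewrite leNgt; apply/negP => lt.
  by apply: nd1; apply: mono hd; apply: ltW.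
have hE : classical_sets.has_inf E by split; [exists 2 | exists d1].
have d1E : d1 <= inf E by apply: lb_le_inf => //; exists 2.
exists (inf E).
  by rewrite (lt_le_trans d10 d1E) /=; apply: ge_inf => //; exists d1.
split=> [eta eta0|eta /andP[eta0 etad] h].
  have [d [_ hd] lt] := inf_adherent eta0 hE.
  by apply: mono hd; apply: ltW.
have : inf E <= inf E - eta.
  by apply: ge_inf; [exists d1 | split=> //; rewrite subr_gt0].
by lra.
Qed.

(** For a dense set of [o] the section [B o], restricted to a fixed subspace of
    dimension [m0], contains a line, and some line serves many [o]. The bound depends
    on [m0] but not on the dimension [#|I|]. *)
Lemma popular_line T (t0 : T) (d : R) m0 : 0 < d ->
  (forall I, (m0 <= #|I|)%N ->
    forall A : pred {ffun I -> T}, d / 2 <= mu R A -> has_line A) ->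
  forall (I O : finType) (o0 : O), (m0 <= #|I|)%N ->
  forall B : O -> pred {ffun I -> T},
  (forall u, d <= mu R (B^~ u)) ->
  exists2 x : {ffun I -> option T}, has_None x &
    d / 2 / #|{ffun 'I_m0 -> option T}|%:R <=
      mu R (fun o => [forall t, B o (subst x t)]).
Proof.
move=> d0 hm0 I O o0 mI B dB.
have d2 : 0 < d / 2 by rewrite divr_gt0.
have La0 : 0 < #|{ffun 'I_m0 -> option T}|%:R :> R.
  by rewrite ltr0n; apply/card_gt0P; exists [ffun=> None].
have [r fr] : exists r : {ffun I -> T + 'I_m0}, full r.
  by apply: full_exists => //; rewrite card_ord.
pose P o := d / 2 <= mu R (fun u => B o (app r u)).
have dP : d / 2 <= mu R P.
  have := @avg_le_mu R _ o0
     (fun o => mu R (fun u => B o (app r u))) (d / 2) (ltW d2)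
     (fun _ => mu_le1 _ _).
  rewrite -/P avg_exchange => h.
  suff : d <= avg (fun y => avg (fun o => (B o (app r y))%:R : R)) by lra.
  rewrite -[leLHS](avg_cst ([ffun=> t0] : {ffun 'I_m0 -> T})).
  by apply: le_avg => u; apply: dB.
pose Q o (L : {ffun 'I_m0 -> option T}) :=
  has_None L && [forall t, B o (app r (subst L t))].
have [||L dL] := @mu_pigeonhole R _ _ P Q; first exact: lt_le_trans dP.
  move=> o Po; have [|L NL AL] := hm0 'I_m0 _ _ Po; first by rewrite card_ord.
  by exists L; rewrite /Q NL; apply/forallP.
have {}dL : d / 2 / #|{ffun 'I_m0 -> option T}|%:R <= mu R (Q^~ L).
  by apply: le_trans dL; rewrite ler_pM2r ?invr_gt0.
have NL : has_None L.
  have : 0 < mu R (Q^~ L) by apply: lt_le_trans dL; rewrite divr_gt0.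
  case: (boolP (has_None L)) => // nN; rewrite /mu /avg big1 ?mul0r ?ltxx //.
  by move=> o _; rewrite /Q (negbTE nN).
exists (app (wlift r) L); first exact/has_None_app/NL/full_wlift.
apply: le_trans dL _; apply: mu_le => o /andP[_ /forallP h].
by apply/forallP => t; rewrite subst_app.
Qed.

(** Over [option T] the line with wildcards at the [None] of [x] consists of [x] and
    of the words [wsome (subst x t)]. *)
Lemma line_free_subst T (I : finType) (B : pred {ffun I -> option T}) :
  ~ has_line B -> forall x, has_None x -> B x ->
  ~~ [forall t, B (wsome (subst x t))].
Proof.
move=> nB x Nx Bx; apply/negP => /forallP h; apply: nB.
exists [ffun i => if x i is Some a then Some (Some a) else None].
  have /existsP[i /eqP xi] := Nx.
  by apply/existsP; exists i; rewrite ffunE xi.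
case=> [t|]; last first.
  congr (is_true (B _)): Bx; apply/ffunP => i; rewrite !ffunE.
  by case: (x i).
congr (is_true (B _)): (h t); apply/ffunP => i; rewrite !ffunE.
by case: (x i).
Qed.

(** Let [d] be the threshold of [line_threshold] and take a line-free set [B] of density
    nearly [d] in words split into two blocks. By the choice of [d], all sections of
    [B] at words [x] of the first block have density nearly [d]. Call a line over [T] in
    the first block good if, for at least a proportion [theta] of the words [o] of the
    second block, all its points followed by [o] are in [B]. By [graham_rothschild] the
    lines of some subspace are all good or all bad, and by [popular_line] they are good.
    In this subspace, for each [o], let [D o t x] say that replacing [None] by [Some t]
    in [x] leads into [B]. These sets are insensitive, and since there are no lines,
    [B] is almost disjoint from their intersection, which has average density at
    least about [theta]. So [B] would be denser than [d] on the complement, by a definite amount,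
    whereas [avg_compl_insens_le] shows that it is not. *)
Lemma DHJ_option T (t0 : T) : DHJ R T -> DHJ R (option T).
Proof.
move=> hT; apply: contrapT => nT.
have [d /andP[d0 d2] [above below]] := line_threshold nT.
have d4 : 0 < d / 2 / 2 by rewrite !divr_gt0.
have [m0 hm0] := hT _ d4.
pose La := #|{ffun 'I_m0 -> option T}|.
have La1 : 1 <= La%:R :> R.
  by rewrite ler1n; apply/card_gt0P; exists [ffun=> None].
have La0 : 0 < La%:R :> R by apply: lt_le_trans La1.
pose theta := d / 2 / 2 / La%:R.
have th0 : 0 < theta by rewrite divr_gt0.
have th1 : theta <= 1 / 2 by rewrite ler_pdivrMr //; nra.
(* The four errors made below add up to about [4 * gam], which is less than the gain
   [d * theta = 10 * gam]. *)
pose gam := d * theta / 10.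
have g0 : 0 < gam by rewrite divr_gt0 // mulr_gt0.
have gd : gam <= d / 20 by rewrite /gam; nra.
have [m' hm'] := above _ g0.
have [nt hnt] := avg_compl_insens_le t0 hT m' g0.
have [nr hnr] := mu_no_None_small T g0.
pose m1 := (m0 + nt + nr)%N.
have [m hm] := graham_rothschild t0 (DHJ_coloring t0 hT) m1 bool.
pose M := #|{ffun 'I_m -> option T}|.
have M0 : 1 <= M%:R :> R by rewrite ler1n; apply/card_gt0P; exists [ffun=> None].
(* The sections number at most [M], so an excess of at most [eps] on each forces a
   defect of at most [2 * M * eps = gam] on any single one. *)
pose eps := gam / (2 * M%:R).
have M2 : 0 < 2 * M%:R :> R by lra.
have e0 : 0 < eps by rewrite divr_gt0.
have eM : 2 * M%:R * eps = gam by rewrite mulrC mulfVK // gt_eqF.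
have ed : eps < d by nra.
have [n1 hn1] := above _ e0.
have [I [mnI [A dA nA]]] : exists I : finType, (m + n1 <= #|I|)%N /\
    exists2 A : pred {ffun I -> option T}, d - eps <= mu R A & ~ has_line A.
  apply: contrapT => h; apply: (below eps); first by rewrite e0.
  exists (m + n1)%N => I mnI A dA; apply: contrapT => nA; apply: h.
  by exists I; split=> //; exists A.
have [e ie] : exists e : 'I_m + 'I_n1 -> I, injective e.
  by apply: card_inj; rewrite card_sum !card_ord.
have {dA} [y0 dA] := dense_extend None ie dA.
pose B w := A (app (extend e y0) w).
have nB : ~ has_line B by move=> /has_line_app h; apply/nA/h/full_extend.
rewrite -/B in dA; move: B nB dA => B {nA y0} nB dB.
pose a x := mu R (fun o => B (wcat x o)).
have a_up x : a x <= d + eps.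
  rewrite leNgt; apply/negP => /ltW lt; apply: nB.
  apply: (has_line_app (full_fixl _ x)); apply: hn1; first by rewrite card_ord.
  by under eq_mu do rewrite app_fixl.
have a_lo x : d - gam <= a x.
  have := @le_card_avg R _ (fun x => d + eps - a x) x.
  have x0 : {ffun 'I_m -> option T} := [ffun=> None].
  rewrite avgB (avg_cst x0).
  have -> : avg a = mu R B by rewrite [RHS]avg_cat.
  have h0 z : 0 <= d + eps - a z by rewrite subr_ge0.
  move=> /(_ h0); rewrite -/M => h1.
  have : M%:R * (d + eps - mu R B) <= M%:R * (2 * eps).
    by rewrite ler_pM2l; lra.
  by lra.
pose allB (x : {ffun 'I_m -> option T}) o :=
  [forall t, B (wcat (wsome (subst x t)) o)].
have [|s fs cs] := hm 'I_m _ (fun x => theta <= mu R (allB x)).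
  by rewrite card_ord.
pose C o x := B (wcat (app (wlift s) x) o).
pose D o t x := C o (wsome (subst x t)).
pose o0 : {ffun 'I_n1 -> option T} := [ffun=> None].
have allBE x o : allB (app (wlift s) x) o = [forall t, D o t x].
  by apply: eq_forallb => t; rewrite subst_app -app_wsome.
have nC o : ~ has_line (C o).
  move=> h; apply: nB; apply: (has_line_app (full_fixr _ o)).
  apply: (has_line_app (full_wlift fs)).
  have [L NL hL] := h; exists L => // t; rewrite app_fixr; exact: hL.
have dD x : has_None x -> theta <= mu R (fun o => [forall t, D o t x]).
  have [||u|z Nz hz] := @popular_line T t0 (d / 2) m0 _ hm0 'I_m1 _ o0 _
     (fun o u => C o (wsome u)).
  - by rewrite divr_gt0.
  - by rewrite card_ord /m1 -addnA leq_addr.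
  - by apply: le_trans (a_lo _); lra.
  move=> Nx; under eq_mu do rewrite -allBE.
  rewrite (cs x z Nx Nz); under eq_mu do rewrite allBE.
  exact: hz.
have few : mu R (fun x : {ffun 'I_m1 -> option T} => ~~ has_None x) <= gam.
  by apply: hnr; rewrite card_ord leq_addl.
have tile o : mu R (C o) - gam - (d + gam) * (1 - mu R (fun x => [forall t, D o t x]))
    <= gam.
  pose f x := (C o x)%:R - (d + gam).
  have m1t : (nt <= #|'I_m1|)%N by rewrite card_ord /m1 addnAC leq_addl.
  (* A subspace on which [C o] has density above [d + gam] would contain a line. *)
  have hf : avg (fun x => f x * (~~ [forall t, D o t x])%:R) <= gam.
    apply: hnt => // [t x y xy|x|u fu]; first by rewrite /D xy.
      by rewrite /f; case: (C o x) => /=; lra.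
    rewrite avgB (avg_cst [ffun=> None]) subr_le0 leNgt; apply/negP => /ltW lt.
    apply: (nC o); apply: (has_line_app fu); apply: hm' lt.
    by rewrite card_ord.
  apply: le_trans hf; set P := fun x => [forall t, D o t x].
  have {1}<- := mu_predT R ([ffun=> None] : {ffun 'I_m1 -> option T}).
  rewrite -avgB -avgZ.
  apply: le_trans (_ : avg (fun x => (C o x)%:R - (~~ has_None x)%:R -
     (d + gam) * (true%:R - (P x)%:R)) <= _).
    by rewrite !avgB lerD2r lerD2l lerN2.
  apply: le_avg => x; rewrite /f /P.
  have [h|h] := boolP [forall t, D o t x] => /=; last first.
    by rewrite subr0 !mulr1 lerD2r gerBl.
  rewrite subrr mulr0 subr0 mulr0 subr_le0 ler_nat.
  case Cx: (C o x) => //; case: (boolP (has_None x)) => //= Nx.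
  by have := line_free_subst (nC o) Nx Cx; rewrite h.
(* [Db] is the average density of the intersections of the insensitive sets; all
   words with a [None] are good lines. *)
pose Db := avg (fun o => mu R (fun x => [forall t, D o t x])).
have hDb : theta * (1 - gam) <= Db.
  rewrite /Db /mu avg_exchange.
  apply: le_trans (_ : theta * mu R (@has_None 'I_m1 T) <= _).
    rewrite ler_pM2l //.
    have <- := mu_predT R ([ffun=> None] : {ffun 'I_m1 -> option T}).
    rewrite lerBlDr; apply: le_trans (lerD (lexx _) few).
    by rewrite -avgD; apply: le_avg => x; case: has_None; rewrite ?addr0 ?add0r.
  rewrite -avgZ; apply: le_avg => x; case: (boolP (has_None x)) => [/dD|_].
    by rewrite mulr1.
  by rewrite mulr0 avg_ge0.
have hb : d - gam <= avg (fun o => mu R (C o)).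
  rewrite /mu avg_exchange -[leLHS](avg_cst ([ffun=> None] : {ffun 'I_m1 -> option T})).
  by apply: le_avg => x; apply: a_lo.
have : avg (fun o => mu R (C o) - gam -
    (d + gam) * (1 - mu R (fun x => [forall t, D o t x]))) <= gam.
  by rewrite -[leRHS](avg_cst o0); apply: le_avg.
rewrite !avgB avgZ avgB !(avg_cst o0) -/Db.
have gE : d * theta = 10 * gam by rewrite /gam; field.
clear - d0 d2 th0 g0 gd hDb hb gE.
move: (avg _) hb => b hb h.
have h1 : d * (theta * (1 - gam)) <= d * Db by rewrite ler_pM2l.
have h2 : 0 <= theta * (1 - gam) by rewrite mulr_ge0 //; lra.
have h3 : 0 <= gam * Db by rewrite mulr_ge0 //; lra.
have h4 : d * (theta * (1 - gam)) = 10 * gam * (1 - gam) by rewrite mulrA gE.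
nra.
Qed.

Lemma DHJ_unit : DHJ R unit.
Proof.
move=> d d0; exists 1%N => I /card_gt0P[i0 _] A dA.
exists [ffun=> None]; first by apply/existsP; exists i0; rewrite ffunE.
case; apply: contrapT => nA; move: dA; rewrite leNgt => /negP; apply.
rewrite /mu /avg big1 ?mul0r // => x _; rewrite (_ : x = subst [ffun=> None] tt).
  by case: (A _) nA.
by apply/ffunP => i; case: (x i); rewrite !ffunE.
Qed.

Fixpoint alphabet k : finType := if k is k'.+1 then option (alphabet k') else unit.

Lemma card_alphabet k : #|alphabet k| = k.+1.
Proof. by elim: k => [|k IH] /=; rewrite ?card_unit // card_option IH. Qed.

Lemma DHJ_alphabet k : DHJ R (alphabet k).
Proof.
elim: k => [|k IH]; first exact: DHJ_unit.
have /card_gt0P[t0 _] : (0 < #|alphabet k|)%N by rewrite card_alphabet.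
exact: (DHJ_option t0).
Qed.

End DHJ.

(** * From words to the grid *)

Lemma subst_sum (V : zmodType) (I T : finType) (phi : T -> V)
    (L : {ffun I -> option T}) (t : T) :
  \sum_i phi (subst L t i) =
  \sum_i oapp phi 0 (L i) + phi t *+ #|[pred i | L i == None]|.
Proof.
rewrite -sumr_const (big_mkcond [pred i | L i == None]) -big_split /=.
by apply: eq_bigr => i _; rewrite ffunE; case: (L i) => [u|]; rewrite ?addr0 ?add0r.
Qed.

Definition corner r (m H : nat) (v : {ffun 'I_r -> 'I_m}) : 'rV[int]_r :=
  \row_j ((v j)%:Z + 1 - H%:Z).

(** The grid enlarged by [H] on each side, indexed from $0$, contains every translate
    [y - s] of a point of the grid by a vector of size at most [H]. *)
Lemma mem_corner r (N H : nat) (y s : 'rV[int]_r) :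
  grid r N y -> (forall j, `|s ord0 j| <= H%:Z) ->
  exists v : {ffun 'I_r -> 'I_(N + H.*2).+1}, y = corner H v + s.
Proof.
move=> /forallP gy hs.
exists [ffun j => inord (absz (y ord0 j - s ord0 j - 1 + H%:Z))].
apply/rowP => j; rewrite !mxE ffunE (_ : (0 : 'I_1) = ord0) //.
have := gy j; have := hs j; move: (y _ _) (s _ _) => yj sj.
rewrite ler_norml => /andP[s1 s2] /andP[y1 y2].
by rewrite inordK; lia.
Qed.

Theorem theorem10p3 (R : realType) (delta : R) (hdelta : 0 < delta)
    (r : nat) (hr : (0 < r)%N) (X : {fset 'rV[int]_r}) :
  exists N : nat, (0 < N)%N /\
    forall A : {fset 'rV[int]_r},
      {subset A <= grid r N} ->
      delta * N%:R ^+ r <= #|` A|%:R ->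
      exists (a : 'rV[int]_r) (d : int), 0 < d /\ homothet a d X `<=` A.
Proof.
case Xk : #|` X| => [|k].
  exists 1%N; split=> // A _ _; exists 0, 1; split=> //.
  rewrite (cardfs0_eq Xk); apply/fsubsetP => y /imfsetP[x /=].
  by rewrite in_fset0.
pose phi (t : alphabet k) : 'rV[int]_r := nth 0 (enum_fset X) (enum_rank t).
have phiX x : x \in X -> exists t, x = phi t.
  move=> xX; have lt : (index x (enum_fset X) < #|alphabet k|)%N.
    by rewrite card_alphabet -Xk index_mem.
  by exists (enum_val (Ordinal lt)); rewrite /phi enum_valK nth_index.
have d0 : 0 < delta / 2 ^+ r by rewrite divr_gt0 // exprn_gt0.
have [n Hn] := DHJ_alphabet k d0.
(* All the sums [S w] below lie in the cube of radius [H]; with side [N = 2 * H + 1]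
   the enlarged grid has side [N + 2 * H + 1 = 2 * N], which costs a factor [2 ^+ r] in
   the density. *)
pose K := (\sum_t \sum_j absz (phi t ord0 j))%N.
have phiK t j : `|phi t ord0 j| <= K%:Z.
  rewrite -abszE lez_nat /K (bigD1 t) //= (bigD1 j) //= -addnA.
  exact: leq_addr.
pose H := (n * K)%N; pose N := H.*2.+1.
pose S (w : {ffun 'I_n -> alphabet k}) := \sum_i phi (w i).
have SH w j : `|S w ord0 j| <= H%:Z.
  rewrite /S summxE; apply: le_trans (ler_norm_sum _ _ _) _.
  apply: le_trans (ler_sum _ (fun i _ => phiK (w i) j)) _.
  rewrite sumr_const card_ord -[_ *+ n]mulr_natr /H; lia.
exists N; split=> // A AN dA.
pose W := {ffun 'I_r -> 'I_(N + H.*2).+1}.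
(* For a fixed word, a random translate of [S w] lies in [A] with probability
   [#|` A|%:R / (2 * N)%:R ^+ r]. *)
have hS w : delta / 2 ^+ r <= mu R (fun v : W => corner H v + S w \in A).
  set P := fun v : W => _.
  have AP : (#|` A| <= #|P|)%N.
    rewrite -(size_image (fun v => corner H v + S w) P).
    apply: uniq_leq_size; first exact: fset_uniq.
    move=> y yA; have [v yv] := mem_corner (AN y yA) (SH w).
    by rewrite yv; apply: image_f; rewrite -[_ \in P]/(P v) /P -yv.
  rewrite mu_card ler_pdivlMr; last first.
    by rewrite ltr0n; apply/card_gt0P; exists [ffun=> ord0].
  apply: le_trans (_ : #|` A|%:R <= _); last by rewrite ler_nat.
  apply: le_trans dA; rewrite card_ffun !card_ord natrX.
  have -> : (N + H.*2).+1 = (2 * N)%N by rewrite /N; lia.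
  by rewrite natrM exprMn mulrA mulfVK // expf_neq0 // pnatr_eq0.
have [v] : exists v : W, delta / 2 ^+ r <= mu R (fun w => corner H v + S w \in A).
  apply: (le_avg_ex ([ffun=> ord0] : W)); rewrite avg_exchange.
  have /card_gt0P[t0 _] : (0 < #|alphabet k|)%N by rewrite card_alphabet.
  rewrite -[leLHS](avg_cst ([ffun=> t0] : {ffun 'I_n -> alphabet k})).
  exact: le_avg.
case/Hn=> [|L NL AL]; first by rewrite card_ord.
(* Along the line, the point moves by [phi t] once for each wildcard. *)
exists (corner H v + \sum_i oapp phi 0 (L i)), #|[pred i | L i == None]|%:Z.
split; first by rewrite ltz_nat; apply/card_gt0P; apply/existsP.
apply/fsubsetP => y /imfsetP[x /= /phiX[t ->] ->].
have := AL t; rewrite /S subst_sum addrA.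
by rewrite -natz scaler_nat.
Qed.
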